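(* Let $\mathcal{H}$ be a reproducing kernel Hilbert space on a set $E$ with reproducing kernel $K(z,w)=k_w(z)$, and let $\mathcal{H}_0=\mathrm{span}\{k_z: z\in E\}$ be the space of finite linear combinations $\sum_j\alpha_jk_{z_j}$ with $\alpha_j\in\mathbb{C}$ and $z_j\in E$. Then $\mathcal{H}_0$ is dense in $\mathcal{H}$, and it follows that $\mathcal{H}$ is determined by its reproducing kernel (i.e. any reproducing kernel Hilbert space on $E$ with the same kernel coincides with $\mathcal{H}$).
   Context: A reproducing kernel Hilbert space on a set $E$ is a Hilbert space $\mathcal{H}$ of functions $E\to\mathbb{C}$ (with pointwise operations) for which every evaluation $\varphi\mapsto\varphi(z)$, $z\in E$, is bounded; $k_w\in\mathcal{H}$ is the element with $\varphi(w)=\langle\varphi,k_w\rangle$ for all $\varphi\in\mathcal{H}$, and the reproducing kernel is $K(z,w)=k_w(z)$. *)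

(* Defs.v *)
From HB Require Import structures.
From mathcomp Require Export all_boot all_order all_algebra.
From mathcomp Require Export all_classical all_reals all_analysis.
From mathcomp Require Export complex.
Export numFieldNormedType.Exports.
Export Order.TTheory GRing.Theory Num.Theory.

Set Implicit Arguments.
Unset Strict Implicit.
Unset Printing Implicit Defensive.

Local Open Scope classical_set_scope.
Local Open Scope ring_scope.
Local Open Scope complex_scope.

(* The complex numbers are `R[i]` for `R : realType`. The Hilbert space of
   functions is a complete normed space whose elements are read as functions
   `E -> R[i]` through the injective linear map `rkhs_fun`; `(R[i])^o` is `R[i]`
   seen as a module over itself, so linearity means pointwise operations.
   Forms of type `{dot _ for _}` are linear in the first argument. *)
Record rkhs (R : realType) (E : Type) := RKHS {
  rkhs_space :> completeNormedModType R[i] ;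
  rkhs_dot : {dot rkhs_space for (@Num.conj R[i])} ;
  rkhs_norm_dot : forall f : rkhs_space, `|f| ^+ 2 = rkhs_dot f f ;
  rkhs_fun : {linear rkhs_space -> (E -> (R[i])^o)} ;
  rkhs_fun_inj : injective rkhs_fun ;
  rkhs_eval_bounded : forall z : E, exists M : R,
    forall f : rkhs_space, `|rkhs_fun f z| <= M%:C * `|f| }.

Arguments rkhs_dot {R E} H : rename.
Arguments rkhs_fun {R E} H : rename.

Definition is_kernel (R : realType) (E : Type) (H : rkhs R E)
    (k : E -> H) (K : E -> E -> R[i]) : Prop :=
  (forall (w : E) (f : H), rkhs_fun H f w = rkhs_dot H f (k w)) /\
  (forall z w : E, K z w = rkhs_fun H (k w) z).

Definition kernel_span (R : realType) (E : Type) (H : rkhs R E)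
    (k : E -> H) : set H :=
  [set h | exists (n : nat) (alpha : 'I_n -> R[i]) (z : 'I_n -> E),
    h = \sum_(j < n) alpha j *: k (z j)].

(* The same set of functions `E -> R[i]`, carrying the same inner product. *)
Definition rkhs_coincide (R : realType) (E : Type) (H H' : rkhs R E) : Prop :=
  range (rkhs_fun H) = range (rkhs_fun H') /\
  (forall (f g : H) (f' g' : H'),
    rkhs_fun H f = rkhs_fun H' f' -> rkhs_fun H g = rkhs_fun H' g' ->
    rkhs_dot H f g = rkhs_dot H' f' g').

(* Main.v *)
(** Density: for [f] in [H], a minimizing sequence [h n] for the distance from
    [f] to the span is Cauchy by the parallelogram law, and minimality makes
    [f - h n] asymptotically orthogonal to each [k w], so [h n] converges to [f]
    pointwise; its norm limit, having the same values as [f], is [f].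
    Uniqueness: the kernel determines the norm of a finite combination of the
    [k z], so the copies in [H'] of approximants of [f] are again Cauchy, and
    their limit is the same function as [f], with the same norm. Polarization
    gives the inner product. *)

Require Import Defs.
From mathcomp Require Import ring lra.

Set Implicit Arguments.
Unset Strict Implicit.
Unset Printing Implicit Defensive.

Local Open Scope classical_set_scope.
Local Open Scope ring_scope.
Local Open Scope complex_scope.

(** * Convergence over [R[i]] from rates on squared norms *)

Lemma complex_gt0P (R : realType) (e : R[i]) :
  0 < e -> exists2 r : R, 0 < r & e = r%:C.
Proof.
by case: e => a b; rewrite ltcE /= => /andP[/eqP -> a0]; exists a.
Qed.

Lemma near_inv_lt_sqr (R : realType) (C : R) (e : R[i]) : 0 < e ->
  \forall n \near \oo, (C / n.+1%:R)%:C < e ^+ 2.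
Proof.
move=> /complex_gt0P[r r0 ->].
have : (fun n => C * harmonic n) @ \oo --> (0 : R).
  rewrite -[X in _ --> X](mulr0 C); apply: cvgM; first exact: cvg_cst.
  exact: cvg_harmonic.
move=> /cvgrPdist_lt /(_ (r ^+ 2)); rewrite exprn_gt0// => /(_ isT).
apply: filterS => n; rewrite sub0r normrN -rmorphXn ltcR.
exact/le_lt_trans/ler_norm.
Qed.

Lemma cvg_sqr_rate (R : realType) (V : normedModType R[i]) (u : nat -> V)
    (l : V) (C : R) :
  (forall n, `|l - u n| ^+ 2 <= (C / n.+1%:R)%:C) -> u @ \oo --> l.
Proof.
move=> uC; apply/cvgrPdist_lt => e e0.
have := near_inv_lt_sqr C e0; apply: filterS => n nC.
by rewrite -(@ltr_pXn2r _ 2) ?nnegrE ?(ltW e0) ?normr_ge0// (le_lt_trans (uC n)).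
Qed.

Lemma cvg_sqr_cauchy_rate (R : realType) (V : completeNormedModType R[i])
    (u : nat -> V) (C : R) :
  (forall m n, `|u m - u n| ^+ 2 <= (C / m.+1%:R + C / n.+1%:R)%:C) ->
  cvg (u @ \oo).
Proof.
move=> uC; apply/cauchy_cvgP/cauchy_exP => e e0.
have e20 : 0 < e / 2 by rewrite divr_gt0.
have [N _ NC] := near_inv_lt_sqr C e20.
exists (u N); exists N => // n Nn.
rewrite -ball_normE /ball_ /=.
rewrite -(@ltr_pXn2r _ 2) ?nnegrE ?(ltW e0) ?normr_ge0//.
apply: le_lt_trans (uC N n) _.
rewrite rmorphD /=.
(* Two of the four quarters of [e ^+ 2] dominate the two rate terms; the other two are positive
   slack. *)
have -> : e ^+ 2 = (e / 2) ^+ 2 + (e / 2) ^+ 2 + (e / 2) ^+ 2 + (e / 2) ^+ 2.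
  by field.
rewrite -[X in X < _]addr0 -(addrA (_ + _)) ltrD//.
  by rewrite ltrD//; apply: NC => /=.
by rewrite addr_gt0// exprn_gt0.
Qed.

(** * Squared norms and point evaluations *)

Lemma dot_sub_proj (C : numClosedFieldType) (U : lmodType C)
    (form : {dot U for Num.conj}) (u v : U) (t : C) : t \is Num.real ->
  form (u - (t * form u v) *: v) (u - (t * form u v) *: v) =
  form u u - `|form u v| ^+ 2 * (2 * t - t * t * form v v).
Proof.
move=> /conj_Creal tE.
rewrite dnormB dnormZ linearZr_LR /= !normCK !rmorphM /= !conjCK tE.
ring.
Qed.

Section InnerProduct.
Variables (R : realType) (E : Type) (H : rkhs R E).
Implicit Types f g u v : H.

(** Norms here take values in [R[i]]; a squared norm in [R] gives access to infima and real
    arithmetic. *)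
Definition sqnorm f : R := complex.Re (`|f| ^+ 2).

Lemma sqnormE f : `|f| ^+ 2 = (sqnorm f)%:C.
Proof. by rewrite RRe_real// realX// normr_real. Qed.

Lemma sqnorm_ge0 f : 0 <= sqnorm f.
Proof. by rewrite -lecR -sqnormE exprn_ge0. Qed.

Lemma sqnorm_double f : sqnorm (2 *: f) = 4 * sqnorm f.
Proof.
apply: (@complexI R); rewrite rmorphM /= -!sqnormE normrZ exprMn.
rewrite normr_nat -natrX.
by rewrite rmorph_nat.
Qed.

Lemma parallelogram u v :
  sqnorm (u + v) + sqnorm (u - v) = 2 * sqnorm u + 2 * sqnorm v.
Proof.
apply: (@complexI R); rewrite !rmorphD !rmorphM /= -!sqnormE !rkhs_norm_dot.
rewrite dnormD dnormB rmorph_nat; ring.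
Qed.

(** Orthogonal projection along [v] is the case where [t] inverts [sqnorm v]. Leaving [t] free
    allows [v = 0]. *)
Lemma sqnorm_sub_proj u v (t : R) :
  sqnorm (u - (t%:C * rkhs_dot H u v) *: v) =
  sqnorm u - complex.Re (`|rkhs_dot H u v| ^+ 2) * (2 * t - t ^+ 2 * sqnorm v).
Proof.
have tE : (2 * t - t ^+ 2 * sqnorm v)%:C =
    2 * t%:C - t%:C * t%:C * (sqnorm v)%:C :> R[i].
  by rewrite rmorphB !rmorphM /= rmorph_nat.
have PE := @RRe_real R (`|rkhs_dot H u v| ^+ 2) (realX _ (normr_real _)).
set P := complex.Re _ in PE *.
apply: (@complexI R); rewrite rmorphB rmorphM /= tE PE -!sqnormE !rkhs_norm_dot.
by rewrite dot_sub_proj//; apply/complex_realP; exists t.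
Qed.

End InnerProduct.

Lemma rkhs_fun_cvg (R : realType) (E : Type) (H : rkhs R E) (u : nat -> H)
    (f : H) (z : E) :
  u @ \oo --> f -> (fun n => rkhs_fun H (u n) z) @ \oo --> rkhs_fun H f z.
Proof.
have [M HM] := rkhs_eval_bounded H z.
(* The bound [M] need not be positive, so division uses [|M| + 1] in its place. *)
have M0 : 0 < `|M| + 1 by rewrite ltr_wpDl.
have M0C : 0 < (`|M| + 1)%:C :> R[i] by rewrite ltcR.
move=> /cvgrPdist_lt uf; apply/cvgrPdist_lt => e e0.
have := uf (e / (`|M| + 1)%:C); rewrite divr_gt0// => /(_ isT).
apply: filterS => n un.
have -> : rkhs_fun H f z - rkhs_fun H (u n) z = rkhs_fun H (f - u n) z.
  by rewrite linearB.
apply: le_lt_trans (HM _) _.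
rewrite ltr_pdivlMr// mulrC in un; apply: le_lt_trans un.
rewrite ler_wpM2r// lecR; apply: le_trans (ler_norm _) _.
by rewrite lerDl.
Qed.

(** * Approximation from the span of the kernels *)

Section KernelSpan.
Variables (R : realType) (E : Type) (H : rkhs R E) (k : E -> H).

Lemma kernel_span0 : kernel_span k 0.
Proof.
(* [E] may be empty, so the empty family of points is built from the emptiness of ['I_0]. *)
exists 0%N, (fun=> 0), (fun i : 'I_0 => False_rect E (notF (ltn_ord i))).
by rewrite big_ord0.
Qed.

Lemma kernel_spanZ (a : R[i]) (h : H) :
  kernel_span k h -> kernel_span k (a *: h).
Proof.
move=> [n [alpha [z ->]]]; exists n, (fun j => a * alpha j), z.
by rewrite scaler_sumr; apply: eq_bigr => j _; rewrite scalerA.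
Qed.

Lemma kernel_spanD (h h' : H) :
  kernel_span k h -> kernel_span k h' -> kernel_span k (h + h').
Proof.
move=> [n [a [z ->]]] [n' [a' [z' ->]]].
exists (n + n')%N,
  (fun j : 'I_(n + n') =>
    match fintype.split j with inl i => a i | inr i => a' i end),
  (fun j : 'I_(n + n') =>
    match fintype.split j with inl i => z i | inr i => z' i end).
rewrite big_split_ord /=; congr (_ + _); apply: eq_bigr => j _.
  by rewrite (unsplitK (inl j)).
by rewrite (unsplitK (inr j)).
Qed.

Lemma kernel_span_kernel (w : E) : kernel_span k (k w).
Proof. by exists 1%N, (fun=> 1), (fun=> w); rewrite big_ord1 scale1r. Qed.

End KernelSpan.

Section Approximation.
Variables (R : realType) (E : Type) (H : rkhs R E) (k : E -> H).
Hypothesis reproducing :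
  forall (w : E) (f : H), rkhs_fun H f w = rkhs_dot H f (k w).

Lemma minimizing_sequence (f : H) : exists (d : R) (h : nat -> H),
  [/\ forall g, kernel_span k g -> d <= sqnorm (f - g),
      forall n, kernel_span k (h n) &
      forall n, sqnorm (f - h n) <= d + n.+1%:R^-1].
Proof.
pose D := [set sqnorm (f - g) | g in kernel_span k].
have infD : has_inf D.
  split; first by exists (sqnorm (f - 0)), 0 => //; exact: kernel_span0.
  by exists 0 => _ [g _ <-]; exact: sqnorm_ge0.
have /choice[h hP] (n : nat) : exists g, kernel_span k g /\
    sqnorm (f - g) <= inf D + n.+1%:R^-1.
  have [|_ [g gS <-] gD] := @inf_adherent _ D n.+1%:R^-1 _ infD.
    by rewrite invr_gt0.
  by exists g; split => //; exact: ltW.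
exists (inf D), h; split=> [g gS|n|n]; last 2 first.
- by case: (hP n).
- by case: (hP n).
by apply: ge_inf; [case: infD|exists g].
Qed.

(** The explicit Cauchy rate is kept because it depends on norms of span elements only, so it
    carries over to another space with the same kernel. *)
Lemma kernel_span_approx (f : H) : exists h : nat -> H,
  [/\ forall n, kernel_span k (h n),
      forall m n, `|h m - h n| ^+ 2 <= (2 / m.+1%:R + 2 / n.+1%:R)%:C &
      h @ \oo --> f].
Proof.
have [d [h [dP hS hd]]] := minimizing_sequence f.
have rate m n : `|h m - h n| ^+ 2 <= (2 / m.+1%:R + 2 / n.+1%:R)%:C.
  (* The midpoint of [h n] and [h m] lies in the span, so the sum term is at least [4 * d], which
     cancels the [d] terms of the two upper bounds. *)
  have := parallelogram (f - h n) (f - h m).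
  have -> : f - h n - (f - h m) = h m - h n.
    by rewrite opprB addrCA addrAC subrr add0r.
  have -> : f - h n + (f - h m) =
      (2 : R[i]) *: (f - (2^-1 : R[i]) *: (h n + h m)).
    rewrite scalerBr scalerA divff// scale1r scaler_nat mulr2n.
    by rewrite opprD addrACA.
  have := dP _ (kernel_spanZ 2^-1 (kernel_spanD (hS n) (hS m))).
  rewrite sqnormE lecR sqnorm_double.
  move: (hd n) (hd m); set a := n.+1%:R^-1; set b := m.+1%:R^-1.
  lra.
exists h; split => //.
have /cvg_ex[g hg] : cvg (h @ \oo) by exact: cvg_sqr_cauchy_rate rate.
suff <- : g = f by [].
apply: rkhs_fun_inj; apply/funext => w.
apply: (norm_cvg_unique (rkhs_fun_cvg (z := w) hg)).
apply: (@cvg_sqr_rate _ _ _ _ (sqnorm (k w) + 1)) => n.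
have -> : rkhs_fun H f w - rkhs_fun H (h n) w = rkhs_fun H (f - h n) w.
  by rewrite linearB.
rewrite reproducing.
set p := rkhs_dot H (f - h n) (k w).
set s := sqnorm (k w).
have s0 : 0 <= s := sqnorm_ge0 _.
have -> : `|p| ^+ 2 = (complex.Re (`|p| ^+ 2))%:C.
  by rewrite RRe_real// realX// normr_real.
have P0 : 0 <= complex.Re (`|p| ^+ 2).
  by rewrite -lecR RRe_real ?realX ?normr_real// exprn_ge0.
rewrite lecR; set P := complex.Re _ in P0 *.
(* The optimal step [p / s] would require [s != 0]; [p / (s + 1)] loses only a
   bounded factor. *)
have /dP : kernel_span k (h n + ((s + 1)^-1%:C * p) *: k w).
  by apply: kernel_spanD => //; apply/kernel_spanZ/kernel_span_kernel.
rewrite opprD addrA sqnorm_sub_proj -/p -/P -/s.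
set t := (s + 1)^-1 => dt.
have ts : t * (s + 1) = 1 by rewrite mulVf// gt_eqF// ltr_wpDl.
have t0 : 0 < t by rewrite invr_gt0 ltr_wpDl.
(* Since [t * s = 1 - t], the factor [2 * t - t ^+ 2 * s] equals [t + t ^+ 2], hence is at least
   [t]; minimality of [d] bounds its product with [P]. *)
have Pt : P * t <= n.+1%:R^-1.
  have : P * t <= P * (2 * t - t ^+ 2 * s).
    apply: ler_wpM2l => //; nra.
  by move: (hd n) dt; set a := n.+1%:R^-1; set b := P * (_ - _); lra.
have -> : P = (P * t) * (s + 1) by rewrite -mulrA ts mulr1.
by rewrite mulrC; apply: ler_wpM2l => //; rewrite addr_ge0.
Qed.

End Approximation.

Lemma kernel_span_dense (R : realType) (E : Type) (H : rkhs R E) (k : E -> H)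
    (K : E -> E -> R[i]) : is_kernel k K -> dense (kernel_span k).
Proof.
move=> [kP _] O [f Of] Oo.
have [h [hS _ hf]] := kernel_span_approx kP f.
have [N _ NO] := hf O (open_nbhs_nbhs (conj Oo Of)).
by exists (h N); split; [exact: (NO N (leqnn N))|exact: hS].
Qed.

(** * Transfer between two spaces with the same kernel *)

Section SameKernel.
Variables (R : realType) (E : Type) (K : E -> E -> R[i]).

(** Same coefficients and points give the same function. By the reproducing property, pairing it
    with the combination itself only involves its values at those points, so the norms agree. *)
Lemma kernel_span_transfer (H H' : rkhs R E) (k : E -> H) (k' : E -> H') :
  is_kernel k K -> is_kernel k' K -> forall h, kernel_span k h ->
  exists h', [/\ kernel_span k' h', rkhs_fun H h = rkhs_fun H' h' &
                 `|h| = `|h'|].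
Proof.
move=> [kP kK] [kP' kK'] _ [n [a [z ->]]].
set h := \sum_(j < n) _; pose h' := \sum_(j < n) a j *: k' (z j).
have hh' : rkhs_fun H h = rkhs_fun H' h'.
  rewrite /h /h' !linear_sum; apply: eq_bigr => j _; rewrite !linearZ.
  by congr (_ *: _); apply/funext => w; rewrite -kK -kK'.
exists h'; split=> //; first by exists n, a, z.
apply/eqP; rewrite -(@eqrXn2 _ 2)//; apply/eqP; rewrite !rkhs_norm_dot.
rewrite {2}/h {2}/h' !linear_sumr; apply: eq_bigr => j _.
by rewrite !linearZr_LR /= -kP -kP' hh'.
Qed.

Lemma same_kernel_transfer (H H' : rkhs R E) (k : E -> H) (k' : E -> H') :
  is_kernel k K -> is_kernel k' K -> forall f : H,
  exists f' : H', rkhs_fun H f = rkhs_fun H' f' /\ `|f| = `|f'|.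
Proof.
move=> hk hk' f.
have [h [hS rate hf]] := kernel_span_approx (proj1 hk) f.
have /choice[h' hP] n := kernel_span_transfer hk hk' (hS n).
have rate' m n : `|h' m - h' n| ^+ 2 <= (2 / m.+1%:R + 2 / n.+1%:R)%:C.
  have := rate m n; suff -> : `|h m - h n| = `|h' m - h' n| by [].
  (* The copy [g] of the difference is the difference of the copies, by injectivity of
     [rkhs_fun]. *)
  have [|g [_ hg ->]] := kernel_span_transfer hk hk' (h := h m - h n).
    by apply: kernel_spanD => //; rewrite -scaleN1r; exact: kernel_spanZ.
  congr `|_|; apply: rkhs_fun_inj.
  by rewrite -hg !linearB; case: (hP m) => _ -> _; case: (hP n) => _ -> _.
have /cvg_ex[f' hf'] : cvg (h' @ \oo) by exact: cvg_sqr_cauchy_rate rate'.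
exists f'; split.
  apply/funext => w; apply: (norm_cvg_unique (rkhs_fun_cvg (z := w) hf)).
  rewrite (_ : (fun n => _) = (fun n => rkhs_fun H' (h' n) w)).
    exact: rkhs_fun_cvg.
  by apply/funext => n; case: (hP n) => _ ->.
apply: (norm_cvg_unique (cvg_norm hf)).
rewrite (_ : (fun n => _) = (fun n => `|h' n|)); first exact: cvg_norm hf'.
by apply/funext => n; case: (hP n).
Qed.

End SameKernel.

(** With [d = F u v], the sum [u + v] yields [d + d^*] and [u + 'i *: v] yields
    [- 'i * d + 'i * d^*]; together they determine [d]. *)
Lemma dot_polarization (C : numClosedFieldType) (U U' : lmodType C)
    (F : {dot U for Num.conj}) (F' : {dot U' for Num.conj})
    (u v : U) (u' v' : U') :
  F u u = F' u' u' -> F v v = F' v' v' ->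
  F (u + v) (u + v) = F' (u' + v') (u' + v') ->
  F (u + 'i *: v) (u + 'i *: v) = F' (u' + 'i *: v') (u' + 'i *: v') ->
  F u v = F' u' v'.
Proof.
move=> uu vv; rewrite !dnormD !dnormZ uu vv !linearZr_LR /= => /addrI re /addrI.
rewrite !rmorphM /= !conjCK conjCi => im.
have i2 : 2 * 'i != 0 :> C by rewrite mulf_neq0 ?neq0Ci ?pnatr_eq0.
have dE (d : C) : 2 * 'i * d = 'i * (d + d^*) - (- 'i * d + 'i * d^*) by ring.
by apply: (mulfI i2); rewrite !dE re im.
Qed.

Theorem proposition2p25 (R : realType) (E : Type) (H : rkhs R E)
    (k : E -> H) (K : E -> E -> R[i]) (hK : is_kernel k K) :
  dense (kernel_span k) /\
  (forall (H' : rkhs R E) (k' : E -> H'), is_kernel k' K -> rkhs_coincide H H').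
Proof.
split; first exact: kernel_span_dense hK.
move=> H' k' hK'.
have dotE (f : H) (f' : H') : rkhs_fun H f = rkhs_fun H' f' ->
    rkhs_dot H f f = rkhs_dot H' f' f'.
  move=> ff'; rewrite -!rkhs_norm_dot.
  (* The transferred element [g] has the same function as [f'], hence equals it. *)
  have [g [fg ->]] := same_kernel_transfer hK hK' f.
  by congr (`|_| ^+ 2); apply: rkhs_fun_inj; rewrite -fg.
split.
  apply/seteqP; split=> _ [f _ <-].
    by have [f' [-> _]] := same_kernel_transfer hK hK' f; exists f'.
  by have [f' [-> _]] := same_kernel_transfer hK' hK f; exists f'.
move=> f g f' g' ff' gg'.
by apply: dot_polarization; apply: dotE => //; rewrite !linearD ?linearZ ff' gg'.
Qed.
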